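(* Let $G$ and $H$ be arbitrary connected non-trivial graphs, where $H$ is not a complete graph and $G$ is a graph with $|Ext(G)|\geq 2$ that is not isomorphic to $K_2$. Then $tn(G\circ H)=3\cdot tn(G)$ if and only if the following four conditions hold: (1) $tn(G)=2$ and $Ext(G)=\{u,v\}$ for two distinct vertices $u,v\in V(G)$; (2) $tn(H)>2$; (3) $N_G(x)\cup N_G(y)\neq V(G)$ for any $x,y\in V(G)$; (4) $d_G(u,v)\geq 3$ and, if $d_G(u,v)=3$, then for all adjacent vertices $u',v'$ of $G$ with $u'\in N_G(u)$ and $v'\in N_G(v)$ the following holds: for every $z\in N_G(u')\cup N_G(v')$ there exists $x\notin N_G(u')\cup N_G(v')$ (with $x\in V(G)$) such that $x\notin T_G(u',z)\cup T_G(v',z)$.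
   Context: All graphs are finite, undirected, without loops or multiple edges; a graph is non-trivial if it has at least two vertices. $N_F(x)$ is the open neighborhood of $x$ in $F$ and $d_F$ is the shortest-path distance. The lexicographic product $G\circ H$ has vertex set $V(G)\times V(H)$, and $(g_1,h_1)$, $(g_2,h_2)$ are adjacent if either $g_1g_2\in E(G)$ or ($g_1=g_2$ and $h_1h_2\in E(H)$). For distinct non-adjacent vertices $u,v$ of a graph $F$, a tolled walk between $u$ and $v$ is a sequence of vertices $u,w_1,\ldots,w_k,v$ with $k\ge 1$ such that $w_iw_{i+1}\in E(F)$ for all $1\le i<k$, $uw_i\in E(F)$ if and only if $i=1$, and $vw_i\in E(F)$ if and only if $i=k$. If $uv\in E(F)$, the only tolled walk between $u$ and $v$ is $u,v$; the only tolled walk from $v$ to $v$ is $v$ itself. The toll interval $T_F(u,v)$ is the set of all vertices lying on some tolled walk between $u$ and $v$. A set $S\subseteq V(F)$ is t-convex if $T_F(u,v)\subseteq S$ for all $u,v\in S$. A vertex $s$ is an extreme vertex of $F$ if $V(F)-\{s\}$ is t-convex; $Ext(F)$ is the set of extreme vertices of $F$. A set $S\subseteq V(F)$ is a toll set of $F$ if $\bigcup_{u,v\in S}T_F(u,v)=V(F)$. The toll number $tn(F)$ is the minimum size of a toll set of $F$. *)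

(* Defs.v *)
From mathcomp Require Import all_boot.
From mathcomp Require Import boolp.

Set Implicit Arguments.
Unset Strict Implicit.
Unset Printing Implicit Defensive.

Record sgraph := SGraph {
  svertex :> finType;
  sedge : rel svertex;
  sedge_sym : symmetric sedge;
  sedge_irrefl : irreflexive sedge
}.

Notation "x -- y" := (sedge x y) (at level 30).

Definition nontrivial_graph (F : sgraph) : Prop := 2 <= #|F|.

Definition connected_graph (F : sgraph) : Prop :=
  forall x y : F, connect (@sedge F) x y.

Definition complete_graph (F : sgraph) : Prop :=
  forall x y : F, x != y -> x -- y.

Definition graph_iso (F F' : sgraph) : Prop :=
  exists2 f : F -> F', bijective f & forall x y : F, (f x -- f y) = (x -- y).

Section Kn.
Variable n : nat.
Definition Kn_rel : rel 'I_n := fun i j => i != j.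
Lemma Kn_sym : symmetric Kn_rel.
Proof. by move=> i j; rewrite /Kn_rel eq_sym. Qed.
Lemma Kn_irrefl : irreflexive Kn_rel.
Proof. by move=> i; rewrite /Kn_rel eqxx. Qed.
Definition Kn : sgraph := SGraph Kn_sym Kn_irrefl.
End Kn.

Section Lexicographic.
Variables G H : sgraph.
Definition lex_rel : rel (G * H)%type :=
  fun p q => (p.1 -- q.1) || ((p.1 == q.1) && (p.2 -- q.2)).
Lemma lex_sym : symmetric lex_rel.
Proof.
by move=> p q; rewrite /lex_rel eq_sym (sedge_sym p.1) (sedge_sym p.2).
Qed.
Lemma lex_irrefl : irreflexive lex_rel.
Proof. by move=> p; rewrite /lex_rel !sedge_irrefl andbF. Qed.
Definition lex_product : sgraph := SGraph lex_sym lex_irrefl.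
End Lexicographic.

Section Toll.
Variable F : sgraph.
Implicit Types (u v x y : F) (s w : seq F) (S : {set F}).

Definition nbh x : {set F} := [set y | x -- y].

(* There is an edge-walk with n edges from x to y. *)
Definition has_walk n x y : bool :=
  [exists p : n.-tuple F, path (@sedge F) x p && (last x p == y)].

(* A shortest path has fewer than #|F| edges, so restricting the search to
   [0, #|F|) is harmless; the value is #|F| when y is unreachable from x. *)
Definition dist x y : nat := find (fun n => has_walk n x y) (iota 0 #|F|).

(* w = [:: w_1; ...; w_k] lists the inner vertices of a tolled walk between
   u and v; positions in w are counted from 0, so w_i is nth u w i.-1. *)
Definition tolled_inner u v w : Prop :=
  [/\ 0 < size w,
      forall i, i.+1 < size w -> nth u w i -- nth u w i.+1,
      forall i, i < size w -> (u -- nth u w i <-> i = 0) &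
      forall i, i < size w -> (v -- nth u w i <-> i = (size w).-1)].

Definition tolled_walk u v s : Prop :=
  if u == v then s = [:: v]
  else if u -- v then s = [:: u; v]
  else exists2 w, tolled_inner u v w & s = u :: rcons w v.

Definition toll_interval u v : {set F} :=
  [set x | `[< exists2 s, tolled_walk u v s & x \in s >]].

Definition t_convex S : bool :=
  [forall u in S, forall v in S, toll_interval u v \subset S].

Definition Ext : {set F} := [set s | t_convex ([set: F] :\ s)].

Definition toll_set S : bool :=
  \bigcup_(u in S) \bigcup_(v in S) toll_interval u v == [set: F].

Lemma toll_setT : toll_set [set: F].
Proof.
rewrite /toll_set eqEsubset subsetT; apply/subsetP => x _.
apply/bigcupP; exists x => //; apply/bigcupP; exists x => //.
by rewrite inE; apply/asboolP; exists [:: x]; rewrite /tolled_walk ?eqxx ?inE.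
Qed.

(* By toll_setT the default value [set: F] of arg min is itself a toll set. *)
Definition tn : nat := #|[arg min_(S < [set: F] | toll_set S) #|S|]|.

Lemma tn_leq S : toll_set S -> tn <= #|S|.
Proof.
by move=> tS; rewrite /tn; case: arg_minnP => [|A _]; [exact: toll_setT | exact].
Qed.

Lemma tn_attained : exists2 S, toll_set S & #|S| = tn.
Proof.
by rewrite /tn; case: arg_minnP => [|A tA _]; [exact: toll_setT | exists A].
Qed.

End Toll.

Arguments Ext F : clear implicits.
Arguments tn F : clear implicits.

(* Main.v *)
Require Import Defs.
From mathcomp Require Import all_boot.
From mathcomp Require Import boolp zify.

Set Implicit Arguments.
Unset Strict Implicit.
Unset Printing Implicit Defensive.

(** A vertex [x] is an inner vertex of a tolled walk between non-adjacent [u]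
    and [v] exactly when [x] reaches [v] without entering the neighborhood of
    [u] again and reaches [u] without entering that of [v] again ([between]).
    In the lexicographic product, two vertices from distinct layers therefore
    toll exactly what their projections toll in [G], whole layers at a time,
    while two non-adjacent vertices of the layer of [g] toll the layers of all
    neighbors of [g], plus part of their own layer ([lex_between]).

    Upper bounds. If every vertex of [G] has a neighbor in [B] or lies between
    two vertices of [A :|: B], then taking one vertex in each layer of [A] and
    a non-adjacent pair in each layer of [B] gives a toll set of size at most
    [#|A| + 2 * #|B|] ([tn_lex_leqD]).  With a minimum toll set [D] for [A] and
    one neighbor of each vertex of [D] for [B], this is at most [3 * tn G].
    Something is saved as soon as two vertices of [D] are adjacent or have a
    common neighbor, or a vertex of [D] lies between two others.  Three
    vertices at pairwise distance at least 3 always have one of them between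
    the other two ([far_triple_between]), so equality forces [tn G <= 2]; as
    toll sets contain the extreme vertices, [D] is then [Ext G], with two
    vertices at distance at least 3.  The failure of any other condition
    yields a toll set of size 4 or 5.

    Lower bound. Let [c g] be the number of vertices of a toll set in the layer
    of [g], with total at most 5.  Since [2 < tn H], the layer of an extreme
    vertex contains three vertices of the toll set or has a neighboring layer
    that contains two ([extreme_cov]).  Three vertices in the layers of both [u]
    and [v] are too many, and three in one with a pair next to the other leave
    the layer of that pair uncovered ([heavy_extreme]).  So there are pairs in
    the layers of some neighbors [u'] of [u] and [v'] of [v], with at most one
    further vertex.  Then [u'] and [v'] are adjacent, for otherwise
    [u] would lie between [v'] and the further vertex; and adjacent [u'], [v']
    are excluded by the last two conditions ([no_small_weight]). *)

(** * Tolled walks as pairs of avoiding walks *)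

Section Between.
Variable F : sgraph.
Implicit Types (a b u v x y z : F) (w p : seq F) (S : {set F}).

(** Only the target of a step is constrained: a walk may start at a neighbor of
    [a].  This is how the single neighbor of an end of a tolled walk is
    allowed for.  A walk that visits [a] cannot leave it, so [a] needs no
    separate exclusion. *)
Definition away a : rel F := fun y z => (y -- z) && ~~ (a -- z).

(** The set of inner vertices of the tolled walks between [u] and [v]. *)
Definition between u v x : bool :=
  [&& u != v, ~~ (u -- v), connect (away u) x v & connect (away v) x u].

Lemma betweenC u v x : between u v x = between v u x.
Proof. by rewrite /between eq_sym sedge_sym [X in _ && (_ && X)]andbC. Qed.

Lemma connect_away_neq a x b : a != b -> connect (away a) x b -> x != a.
Proof.
move=> neq_ab /connectP[[|y p] /=]; first by move=> _ <-; rewrite eq_sym.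
case/andP=> /andP[xy nay] _ _; apply: contraNN nay => /eqP <-.
by rewrite xy.
Qed.

Lemma between_neq u v x : between u v x -> (x != u) && (x != v).
Proof.
case/and4P=> neq_uv _ xv xu; rewrite (connect_away_neq neq_uv xv).
by rewrite (connect_away_neq _ xu) // eq_sym.
Qed.

Lemma common_nbr_between u v x :
  u != v -> ~~ (u -- v) -> u -- x -> v -- x -> between u v x.
Proof.
move=> neq_uv nuv ux vx; rewrite /between neq_uv nuv.
by rewrite !connect1 // /away ?(sedge_sym x) ?(sedge_sym v u) ?ux ?vx.
Qed.

(** The asymmetry of [away] comes only from the start of the walk. *)
Lemma connect_away_sym a x b :
  ~~ (a -- x) -> connect (away a) x b -> connect (away a) b x.
Proof.
move=> nax /connectP[p]; elim: p x nax => [|y p IHp] x nax /= => [_ ->//|].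
case/andP=> /andP[xy nay] pth bE; apply: connect_trans (IHp y nay pth bE) _.
by apply: connect1; rewrite /away sedge_sym xy.
Qed.

(** After [x], a tolled walk meets no neighbor of [u], as only its first inner
    vertex is one; before [x], it meets no neighbor of [v]. *)
Lemma tolled_between u v w x :
  u != v -> ~~ (u -- v) -> tolled_inner u v w -> x \in w -> between u v x.
Proof.
move=> neq_uv nuv [w_gt0 w_path w_u w_v] xw.
rewrite /between neq_uv nuv /=.
have lt_i : index x w < @size F w by rewrite index_mem.
have <- : nth u w (index x w) = x by rewrite nth_index.
move: (index x w) lt_i => i lt_i {x xw}.
apply/andP; split.
  move: {2}(size w - i) (leqnn (size w - i)) => n.
  elim: n i lt_i => [|n IHn] i lt_i le_n; first by exfalso; lia.
  have [eq_i|neq_i] := eqVneq i (size w).-1.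
    have v_i : v -- nth u w i by apply/w_v.
    by apply: connect1; rewrite /away sedge_sym v_i.
  have lt_i1 : i.+1 < size w by lia.
  apply: connect_trans (IHn i.+1 lt_i1 _); last by lia.
  apply: connect1; rewrite /away w_path //=.
  by apply/negP => /(w_u _ lt_i1).
elim: i lt_i => [|i IHi] lt_i.
  have u_0 : u -- nth u w 0 by apply/w_u.
  by apply: connect1; rewrite /away sedge_sym u_0 sedge_sym nuv.
apply: connect_trans (IHi (ltnW lt_i)).
apply: connect1; rewrite /away sedge_sym w_path //=.
by apply/negP => /(w_v _ (ltnW lt_i)); lia.
Qed.

(** Truncating a walk towards [b] at the first neighbor of [b] gives one half
    of a tolled walk that ends at [b]. *)
Lemma first_hit a x b : x != b -> connect (away a) x b ->
  exists p, [/\ path (away a) x p, b -- last x p &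
                all (fun y => ~~ (b -- y)) (belast x p)].
Proof.
move=> + /connectP[p]; elim: p x => [|y p IHp] x neq_xb /=.
  by move=> _ bE; rewrite bE eqxx in neq_xb.
case/andP=> /[dup] /andP[xy nay] axy pth bE.
have [bx|nbx] := boolP (b -- x); first by exists [::].
have neq_yb : y != b by apply: contraNN nbx => /eqP <-; rewrite sedge_sym.
have [q [pth_q bq nbq]] := IHp y neq_yb pth bE.
by exists (y :: q); split=> //=; [rewrite axy | rewrite nbx].
Qed.

Lemma path_away a x p :
  path (away a) x p = path (@sedge F) x p && all (fun y => ~~ (a -- y)) p.
Proof.
elim: p x => //= y p IHp x; rewrite IHp /away.
by case: (x -- y); case: (a -- y); rewrite //= andbF.
Qed.

(** The same inner list is read from both ends: its head is the only neighbor
    of [u], its last element the only neighbor of [v]. *)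
Lemma tolled_inner_split u v a w w' b :
  a :: w = rcons w' b -> path (@sedge F) a w ->
  u -- a -> all (fun y => ~~ (u -- y)) w ->
  v -- b -> all (fun y => ~~ (v -- y)) w' -> tolled_inner u v (a :: w).
Proof.
move=> eq_w pth ua /all_nthP nuw vb /all_nthP nvw; split=> // [i lt_i|[|i]|i].
- by have /(pathP u) := pth; apply.
- by split.
- by move=> /= lt_i; split=> // uw; case/negP: (nuw u i lt_i).
rewrite eq_w size_rcons nth_rcons ltnS leq_eqVlt => /orP[/eqP eq_i|lt_i].
  by rewrite eq_i ltnn eqxx.
rewrite lt_i; split=> [/(negP (nvw u i lt_i))|eq_i] //.
by rewrite eq_i ltnn in lt_i.
Qed.

(** The walks from [x] to the first neighbor of [u] and to the first neighbor
    of [v] fit together: if [x] is itself a neighbor of [u] or of [v], the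
    corresponding half is empty. *)
Lemma between_tolled u v x :
  between u v x -> exists2 w, tolled_inner u v w & x \in w.
Proof.
move=> /[dup] /between_neq/andP[neq_xu neq_xv] /and4P[neq_uv nuv xv xu].
have [p [pth_p up nup]] := first_hit neq_xu xu.
have [q [pth_q vq nvq]] := first_hit neq_xv xv.
move: pth_p pth_q; rewrite !path_away => /andP[pth_p nvp] /andP[pth_q nuq].
have eq_w : last x p :: rev (belast x p) ++ q = rev p ++ x :: q.
  by rewrite -cat_cons -rev_rcons -lastI rev_cons cat_rcons.
exists (last x p :: rev (belast x p) ++ q); last first.
  by rewrite eq_w mem_cat mem_head orbT.
apply: (@tolled_inner_split _ _ _ _ (rev p ++ belast x q) (last x q)) => //.
- by rewrite eq_w rcons_cat -lastI.
- rewrite cat_path rev_path (eq_path (e' := @sedge F)) ?pth_p.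
    case: (p) => [|y p'] //=; rewrite rev_cons last_rcons //=.
  by move=> y z /=; rewrite sedge_sym.
- by rewrite all_cat all_rev nup nuq.
by rewrite all_cat all_rev nvp nvq.
Qed.

Lemma between_interval u v x : between u v x -> x \in toll_interval u v.
Proof.
move=> /[dup] /and4P[neq_uv nuv _ _] /between_tolled[w tw xw].
rewrite inE; apply/asboolP; exists (u :: rcons w v).
  by rewrite /tolled_walk (negPf neq_uv) (negPf nuv); exists w.
by rewrite inE mem_rcons inE xw !orbT.
Qed.

Lemma interval_cases u v x :
  x \in toll_interval u v -> [|| x == u, x == v | between u v x].
Proof.
rewrite inE => /asboolP[s]; rewrite /tolled_walk.
case: eqVneq => [-> ->|neq_uv]; first by rewrite inE => ->.
case: ifPn => [_ ->|nuv [w tw ->]].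
  by rewrite !inE orbA => ->.
rewrite inE mem_rcons inE => /or3P[->|->|xw]; rewrite ?orbT //.
by rewrite (tolled_between neq_uv nuv tw xw) !orbT.
Qed.

Lemma toll_setP S :
  reflect (forall x, x \in S \/ exists u v, [/\ u \in S, v \in S & between u v x])
          (toll_set S).
Proof.
apply: (iffP eqP) => [eqT x|cov].
  have /bigcupP[u uS /bigcupP[v vS /interval_cases]] :
    x \in \bigcup_(u in S) \bigcup_(v in S) toll_interval u v by rewrite eqT inE.
  case/or3P=> [/eqP->|/eqP->|bx]; [by left | by left|].
  by right; exists u, v.
apply/eqP; rewrite eqEsubset subsetT; apply/subsetP => x _.
case: (cov x) => [xS|[u [v [uS vS bx]]]].
  apply/bigcupP; exists x => //; apply/bigcupP; exists x => //.
  by rewrite inE; apply/asboolP; exists [:: x]; rewrite /tolled_walk ?eqxx ?inE.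
apply/bigcupP; exists u => //; apply/bigcupP; exists v => //.
exact: between_interval.
Qed.

Lemma ExtP s : reflect (forall u v, ~~ between u v s) (s \in Ext F).
Proof.
rewrite inE; apply: (iffP forall_inP) => [cvx u v|ext u].
  apply/negP => /[dup] /between_neq/andP[neq_su neq_sv] bs.
  have /cvx/forall_inP/(_ v) : u \in [set: F] :\ s by rewrite !inE eq_sym neq_su.
  rewrite !inE eq_sym neq_sv => /(_ isT)/subsetP/(_ s (between_interval bs)).
  by rewrite !inE eqxx.
rewrite !inE andbT => neq_us; apply/forall_inP => v.
rewrite !inE andbT => neq_vs; apply/subsetP => x xI; rewrite !inE andbT.
apply: contraTneq (interval_cases xI) => ->.
by rewrite !(eq_sym s) (negPf neq_us) (negPf neq_vs) /= ext.
Qed.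

End Between.

(** * Vertices at distance at least three *)

Section Distance.
Variable F : sgraph.
Implicit Types (u v x y : F).

Definition far u v : bool :=
  [&& u != v, ~~ (u -- v) & [forall c, ~~ ((u -- c) && (v -- c))]].

Lemma farC u v : far u v = far v u.
Proof.
rewrite /far eq_sym sedge_sym; congr [&& _, _ & _].
by apply: eq_forallb => c; rewrite andbC.
Qed.

Lemma farP u v :
  reflect [/\ u != v, ~~ (u -- v) & forall c, u -- c -> v -- c -> False]
          (far u v).
Proof.
apply: (iffP and3P) => -[neq_uv nuv].
  by move=> /forallP far_uv; split=> // c uc vc; have:= far_uv c; rewrite uc vc.
move=> far_uv; split=> //; apply/forallP => c; apply/negP => /andP[].
exact: far_uv.
Qed.

(** Walks of length [#|F|] or more are not searched for, but [dist] never
    exceeds [#|F|]. *)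
Lemma dist_leq n x y : has_walk n x y -> dist x y <= n.
Proof.
move=> wn; rewrite leqNgt; apply/negP => lt_n.
have lt_nF : n < #|F|.
  by apply: leq_trans lt_n _; rewrite -[leqRHS](size_iota 0) find_size.
by have:= before_find 0 lt_n; rewrite nth_iota // wn.
Qed.

Lemma leq_dist n x y :
  n <= #|F| -> (forall k, k < n -> ~~ has_walk k x y) -> n <= dist x y.
Proof.
move=> le_nF nw; rewrite leqNgt; apply/negP => lt_n.
have lt_dF : dist x y < #|F| by apply: leq_trans lt_n le_nF.
have := @nth_find _ 0 (fun k => has_walk k x y) (iota 0 #|F|).
rewrite has_find size_iota nth_iota // add0n => /(_ lt_dF).
exact/negP/nw.
Qed.

Lemma has_walkP n x y :
  reflect (exists p, [/\ size p = n, path (@sedge F) x p & last x p = y])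
          (has_walk n x y).
Proof.
apply: (iffP existsP) => [[p /andP[pth /eqP <-]]|[p [sz_p pth <-]]].
  by exists p; rewrite size_tuple.
have sz_p' : size p == n by apply/eqP.
by exists (Tuple sz_p'); rewrite /= pth eqxx.
Qed.

Lemma dist3_far u v : 3 <= dist u v -> far u v.
Proof.
move=> d3; have nw k : k < 3 -> ~ has_walk k u v.
  by move=> lt_k3 /dist_leq; rewrite leqNgt (leq_trans lt_k3 d3).
apply/farP; split=> [|| c uc vc].
- by apply/eqP => eq_uv; apply: (nw 0) => //; apply/has_walkP; exists [::].
- apply/negP => uv; apply: (nw 1) => //; apply/has_walkP; exists [:: v].
  by rewrite /= uv.
apply: (nw 2) => //; apply/has_walkP; exists [:: c; v].
by rewrite /= uc sedge_sym vc.
Qed.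

Hypotheses (Fconn : connected_graph F) (Fnontriv : nontrivial_graph F).

Lemma exists_nbr x : exists y, x -- y.
Proof.
have [z] : exists z, z \in [set~ x].
  apply/set0Pn; rewrite -card_gt0 cardsC1.
  by move: Fnontriv; rewrite /nontrivial_graph; lia.
rewrite !inE => neq_zx; have /connectP[[|y p] /=] := Fconn x z.
  by move=> _ zE; rewrite zE eqxx in neq_zx.
by case/andP=> xy _ _; exists y.
Qed.

(** Connectivity provides a neighbor of [u], hence a third vertex; in a smaller
    graph a failed search would give a value below 3. *)
Lemma far_dist3 u v : far u v -> 3 <= dist u v.
Proof.
case/farP=> neq_uv nuv far_uv; apply: leq_dist.
  have [c uc] := exists_nbr u.
  have: size [:: u; v; c] <= #|F|; last by [].
  rewrite -(card_uniqP _) ?max_card //= !inE negb_or neq_uv andbT /=.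
  apply/andP; split; first by apply: contraTneq uc => ->; rewrite sedge_irrefl.
  by apply: contraNneq nuv => ->.
case=> [|[|[|//]]] _; apply/has_walkP => -[p] [].
- by case: p => //= _ _ /eqP; rewrite (negPf neq_uv).
- case: p => [|a [|//]] //= _; rewrite andbT => ua aE.
  by rewrite -aE ua in nuv.
case: p => [|a [|b [|//]]] //= _; rewrite andbT => /andP[ua ab] bE.
by apply: (far_uv a ua); rewrite sedge_sym -bE.
Qed.

(** On a walk from [u], consider which of the disjoint neighborhoods of [v] and
    [w] is met first: from there, its center is one step away, and the other
    neighborhood has been avoided. *)
Lemma reach_one_first u v w :
  far v w -> connect (away w) u v \/ connect (away v) u w.
Proof.
case/farP=> neq_vw nvw far_vw; have /connectP[p] := Fconn u v.
elim: p u => [|y p IHp] u /=; first by move=> _ ->; left.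
case/andP=> uy pth vE; case: (IHp y pth vE) => [yv|yw].
  have [wy|nwy] := boolP (w -- y); last first.
    by left; apply: connect_trans (connect1 _) yv; rewrite /away uy.
  have [vy|nvy] := boolP (v -- y); first by case: (far_vw y).
  right; apply: (connect_trans (y := y)); apply: connect1.
    by rewrite /away uy.
  by rewrite /away sedge_sym wy.
have [vy|nvy] := boolP (v -- y); last first.
  by right; apply: connect_trans (connect1 _) yw; rewrite /away uy.
have [wy|nwy] := boolP (w -- y); first by case: (far_vw y).
left; apply: (connect_trans (y := y)); apply: connect1.
  by rewrite /away uy.
by rewrite /away sedge_sym vy sedge_sym.
Qed.

(** For each pair among the three vertices, the walk relations that would put
    the third vertex between them are the options offered by
    [reach_one_first].  There are three relations up to symmetry, and each
    application of [reach_one_first] provides one of two of them; hence at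
    least two hold, and they put a vertex between the others. *)
Lemma far_triple_between u v w :
  far u v -> far u w -> far v w ->
  [|| between v w u, between u w v | between u v w].
Proof.
move=> fuv fuw fvw.
have [/farP[euv nuv _] /farP[euw nuw _] /farP[evw nvw _]] := And3 fuv fuw fvw.
have sym a x b :
    far a x -> far a b -> connect (away a) x b = connect (away a) b x.
  by move=> /farP[_ nax _] /farP[_ nab _]; apply/idP/idP; apply: connect_away_sym.
have := (reach_one_first u fvw, reach_one_first v fuw, reach_one_first w fuv).
have [fvu fwu fwv] : [/\ far v u, far w u & far w v] by split; rewrite farC.
rewrite /between euv nuv euw nuw evw nvw /=.
rewrite (sym w u v fwu fwv) (sym v u w fvu fvw) (sym u v w fuv fuw).
by case=> -[[] h1 [] h2] [] h3; rewrite ?h1 ?h2 ?h3 ?orbT.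
Qed.

End Distance.

(** * Toll intervals in a lexicographic product *)

Lemma connect_map (T T' : finType) (r : rel T) (r' : rel T') (f : T -> T') :
  (forall x y, r x y -> connect r' (f x) (f y)) ->
  forall x y, connect r x y -> connect r' (f x) (f y).
Proof.
move=> rr' x y /connectP[p + ->]; elim: p x => [|z p IHp] x //=.
by case/andP=> /rr' xz /IHp; apply: connect_trans.
Qed.

Section LexToll.
Variables G H : sgraph.
Implicit Types (g x : G) (h y : H).
Local Notation GH := (lex_product G H).

Lemma lex_adj g h g' h' :
  ((g, h) : GH) -- (g', h') = (g -- g') || (g == g') && (h -- h').
Proof. by []. Qed.

(** A vertex other than [g] has the same adjacency to [(g, h)] whatever its
    second coordinate, so walks lift with arbitrary second coordinates. *)
Lemma away_lex_lift g h x y b k :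
  x != b -> g != b -> connect (away g) x b ->
  connect (away ((g, h) : GH)) (x, y) (b, k).
Proof.
move=> + neq_gb /connectP[p]; elim: p x y => [|z p IHp] x y neq_xb /=.
  by move=> _ bE; rewrite bE eqxx in neq_xb.
case/andP=> /andP[xz ngz] pth bE.
have neq_zg : z != g.
  by apply: connect_away_neq neq_gb _; apply/connectP; exists p.
have step k' : connect (away ((g, h) : GH)) (x, y) (z, k').
  apply: connect1; rewrite /away !lex_adj xz.
  by rewrite (negPf ngz) (eq_sym g) (negPf neq_zg).
have [->|neq_zb] := eqVneq b z; first exact: step.
by apply: connect_trans (step h) (IHp _ _ _ pth bE); rewrite eq_sym.
Qed.

Lemma away_lex_proj g h (p q : GH) :
  connect (away ((g, h) : GH)) p q -> connect (away g) p.1 q.1.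
Proof.
apply: (connect_map (f := fst)) => -[z k] [z' k'] /=.
rewrite /away !lex_adj negb_or => /andP[/orP[zz'|/andP[/eqP -> _]] /andP[ngz' _]] //.
by apply: connect1; rewrite zz'.
Qed.

Lemma away_layer_lift g h y k :
  connect (away h) y k -> connect (away ((g, h) : GH)) (g, y) (g, k).
Proof.
apply: (connect_map (f := fun y => (g, y) : GH)) => z z' zz'.
by apply: connect1; rewrite /away !lex_adj sedge_irrefl eqxx.
Qed.

(** Once in the layer of [g], a walk that avoids the neighbors of [(g, h)] stays
    there, since the other layers next to it consist of such neighbors. *)
Lemma away_layer_proj g h x y k :
  connect (away ((g, h) : GH)) (x, y) (g, k) ->
  g -- x \/ (g = x /\ connect (away h) y k).
Proof.
case/connectP=> p; elim: p x y => [|[z l] p IHp] x y /=.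
  by move=> _ [-> ->]; right.
rewrite {1}/away !lex_adj negb_or -!andbA => /and4P[xz ngz nhl pth] lE.
have [gz|[eq_gz lk]] := IHp _ _ pth lE; first by rewrite gz in ngz.
subst z; move: xz nhl; rewrite eqxx /= sedge_sym => /orP[->|]; first by left.
case/andP=> /eqP -> yl nhl; right; split=> //.
by apply: connect_trans lk; apply: connect1; rewrite /away yl.
Qed.

Lemma lex_between g h g' h' x y :
  between ((g, h) : GH) (g', h') (x, y) =
  between g g' x ||
  [&& g == g', h != h', ~~ (h -- h') & (g -- x) || (g == x) && between h h' y].
Proof.
have [<-|neq_gg] := eqVneq g g'.
  rewrite {2}/between eqxx /=; apply/idP/idP.
    rewrite /between; case/and4P.
    rewrite lex_adj sedge_irrefl xpair_eqE !eqxx /= => -> -> xh' xh.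
    have [->//|[eq_gx yh']] := away_layer_proj xh'.
    have [->//|[_ yh]] := away_layer_proj xh.
    by rewrite eq_gx eqxx yh yh' orbT.
  case/and3P=> neq_hh nhh'; case/orP=> [gx|/andP[/eqP <-]].
    apply: common_nbr_between; rewrite ?lex_adj ?gx //.
      by rewrite xpair_eqE eqxx.
    by rewrite sedge_irrefl eqxx.
  case/and4P=> _ _ yh' yh; rewrite /between lex_adj xpair_eqE eqxx sedge_irrefl.
  by rewrite neq_hh nhh' !away_layer_lift.
rewrite orbF; apply/idP/idP.
  case/and4P; rewrite lex_adj (negPf neq_gg) /= orbF.
  by move=> _ ngg /away_lex_proj xg' /away_lex_proj xg; apply/and4P.
move=> /[dup] /between_neq/andP[neq_xg neq_xg'] /and4P[_ ngg xg' xg].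
apply/and4P; split.
- by rewrite xpair_eqE negb_and neq_gg.
- by rewrite lex_adj negb_or ngg (negPf neq_gg).
- exact: away_lex_lift.
- by apply: away_lex_lift; rewrite // eq_sym.
Qed.

(** The product of toll sets of the factors is a toll set. *)
Lemma tn_lex_leqM : tn GH <= tn G * tn H.
Proof.
have [D /toll_setP covD <-] := tn_attained G.
have [E /toll_setP covE <-] := tn_attained H.
rewrite -cardsX; apply: tn_leq; apply/toll_setP => -[x y].
have [h hE] : exists h, h \in E.
  by case: (covE y) => [yE|[h [_ [hE _ _]]]]; [exists y | exists h].
case: (covD x) => [xD|[g [g' [gD g'D bx]]]]; last first.
  by right; exists (g, h), (g', h); rewrite lex_between bx !in_setX gD g'D.
case: (covE y) => [yE|[k [k' [kE k'E by_]]]]; first by left; rewrite in_setX xD.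
right; exists (x, k), (x, k'); rewrite lex_between by_ !in_setX xD kE k'E !eqxx.
by case/and4P: by_ => -> -> _ _; rewrite !orbT.
Qed.

(** One vertex in each layer of [A] and a non-adjacent pair in each layer of [B]
    form a toll set: the pair in the layer of [b] tolls all layers next to it,
    and vertices of two layers toll every layer between them. *)
Lemma tn_lex_leqD (A B : {set G}) : ~ complete_graph H ->
  (forall x, (exists2 b, b \in B & b -- x) \/
             exists g g', [/\ g \in A :|: B, g' \in A :|: B & between g g' x]) ->
  tn GH <= #|A| + 2 * #|B|.
Proof.
move=> ncH cov.
have [h [h' neq_hh nhh]] : exists h, exists2 h', h != h' & ~~ (h -- h').
  apply: contrapT => nex; apply: ncH => y y' neq_yy.
  by apply: contrapT => /negP nyy; apply: nex; exists y, y'.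
pose S : {set GH} := setX A [set h] :|: setX B [set h; h'].
have inS g : g \in A :|: B -> (g, h) \in S.
  rewrite /S !inE eqxx /= andbT => /orP[->|->]; rewrite ?orbT //.
have -> : #|A| + 2 * #|B| = #|setX A [set h]| + #|setX B [set h; h']|.
  by rewrite !cardsX cards1 cards2 neq_hh; lia.
apply: leq_trans (leq_card_setU _ _); apply: tn_leq; apply/toll_setP => -[x y].
right; case: (cov x) => [[b bB bx]|[g [g' [gD g'D bx]]]].
  exists (b, h), (b, h'); rewrite lex_between bx neq_hh nhh eqxx orbT.
  by rewrite !inE !eqxx bB /= !orbT.
by exists (g, h), (g', h); rewrite lex_between bx !inS.
Qed.

Definition layer (S : {set GH}) g : {set H} := [set h | (g, h) \in S].

Lemma sum_card_layer (S : {set GH}) : \sum_g #|layer S g| = #|S|.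
Proof.
rewrite -sum1_card (eq_bigr (fun g => \sum_(h | (g, h) \in S) 1)).
  by rewrite pair_big_dep; apply: eq_bigl => -[].
by move=> g _; rewrite -sum1_card; apply: eq_bigl => h; rewrite inE.
Qed.

End LexToll.

(** This is what being a toll set of the product imposes on the numbers [c g] of
    vertices taken in the layers; [k] stands for the toll number of the second
    factor.  The layer of [x] can be covered from a neighboring layer with two
    vertices, from two layers [x] lies between, or from inside. *)
Definition toll_weight (G : sgraph) k (c : G -> nat) : Prop := forall x,
  [\/ exists2 g, 2 <= c g & g -- x,
      exists g g', [/\ 0 < c g, 0 < c g' & between g g' x] | k <= c x].

(** If the first two ways fail, then no vertex of the layer of [x] is tolled
    from another layer, so the layer is tolled by its own vertices, which then
    form a toll set of [H]. *)
Lemma layer_weight (G H : sgraph) (S : {set lex_product G H}) :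
  toll_set S -> toll_weight (tn H) (fun g => #|layer S g|).
Proof.
move=> /toll_setP covS x.
have [?|ndom] := pselect (exists2 g : G, 2 <= #|layer S g| & g -- x).
  by constructor 1.
have [?|nbet] := pselect (exists g g' : G,
  [/\ 0 < #|layer S g|, 0 < #|layer S g'| & between g g' x]).
  by constructor 2.
constructor 3; apply: tn_leq; apply/toll_setP => y.
case: (covS (x, y)) => [|[[g h] [[g' h'] [ghS ghS']]]]; first by left; rewrite inE.
have hL : h \in layer S g by rewrite inE.
have hL' : h' \in layer S g' by rewrite inE.
rewrite lex_between => /orP[bx|/and4P[/eqP eq_gg neq_hh nhh]].
  case: nbet; exists g, g'; split=> //; rewrite card_gt0; apply/set0Pn.
    by exists h.
  by exists h'.
subst g'; case/orP=> [gx|/andP[/eqP eq_gx bhy]]; last first.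
  by subst g; right; exists h, h'.
case: ndom; exists g => //; apply: leq_trans (_ : #|[set h; h']| <= _).
  by rewrite cards2 neq_hh.
by apply/subset_leq_card/subsetP => z; rewrite !inE => /orP[] /eqP ->.
Qed.

(** * Upper bounds from a toll set of the first factor *)

Section UpperBounds.
Variables G H : sgraph.
Hypotheses (Gconn : connected_graph G) (Gnontriv : nontrivial_graph G).
Hypothesis ncH : ~ complete_graph H.
Implicit Types (A B D K : {set G}).
Local Notation GH := (lex_product G H).

(** Each vertex of [D] outside [K] pays for a neighbor of its own, with a pair in
    the layer of that neighbor; [K] is the part of [D] that is taken care of
    more cheaply. *)
Lemma tn_lex_leq_dom A B D K : toll_set D -> D \subset A :|: B ->
  (forall x, x \in K -> (exists2 b, b \in B & b -- x) \/
     exists g g', [/\ g \in D, g' \in D & between g g' x]) ->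
  tn GH <= #|A| + 2 * #|B| + 2 * #|D :\: K|.
Proof.
move=> /toll_setP covD /subsetP sDAB covK.
have [f fP] := choice (exists_nbr Gconn Gnontriv).
have -> : #|A| + 2 * #|B| + 2 * #|D :\: K| = #|A| + 2 * (#|B| + #|D :\: K|) by lia.
have le_B : #|B :|: f @: (D :\: K)| <= #|B| + #|D :\: K|.
  by apply: leq_trans (leq_card_setU _ _) _; rewrite leq_add2l leq_imset_card.
apply: leq_trans (_ : #|A| + 2 * #|B :|: f @: (D :\: K)| <= _); last by lia.
apply: tn_lex_leqD => // x.
have sub g : g \in D -> g \in A :|: (B :|: f @: (D :\: K)).
  by move/sDAB; rewrite !in_setU => /orP[]->; rewrite ?orbT.
have betD g g' : g \in D -> g' \in D -> between g g' x ->
    exists g g', [/\ g \in A :|: (B :|: f @: (D :\: K)),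
                     g' \in A :|: (B :|: f @: (D :\: K)) & between g g' x].
  by move=> gD g'D bx; exists g, g'; split=> //; apply: sub.
have [xK|nxK] := boolP (x \in K).
  case: (covK x xK) => [[b bB bx]|[g [g' [gD g'D bx]]]]; last first.
    by right; apply: betD bx.
  by left; exists b => //; rewrite inE bB.
case: (covD x) => [xD|[g [g' [gD g'D bx]]]]; last by right; apply: betD bx.
left; exists (f x); last by rewrite sedge_sym.
by rewrite inE imset_f ?orbT // !inE nxK.
Qed.

Lemma tn_lex_leq3 : tn GH <= 3 * tn G.
Proof.
have [D tD <-] := tn_attained G.
have := @tn_lex_leq_dom D set0 D set0 tD; rewrite setU0 subxx cards0 setD0.
have -> : #|D| + 2 * 0 + 2 * #|D| = 3 * #|D| by lia.
by apply=> // x; rewrite inE.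
Qed.

(** Adjacent [d] and [d'] dominate each other, so pairs in their two layers
    suffice for both; otherwise one pair in the layer of a common neighbor
    does. *)
Lemma tn_lex_lt_nfar D d d' : toll_set D -> d \in D -> d' \in D -> d != d' ->
  ~~ far d d' -> tn GH < 3 * #|D|.
Proof.
move=> tD dD d'D neq_dd nfar.
have cardD : #|D :\: [set d; d']| = #|D| - 2.
  rewrite cardsD (setIidPr _) ?cards2 ?neq_dd //.
  by apply/subsetP => x; rewrite !inE => /orP[] /eqP ->.
have D_ge2 : 2 <= #|D|.
  apply: leq_trans (_ : #|[set d; d']| <= _); first by rewrite cards2 neq_dd.
  by apply/subset_leq_card/subsetP => x; rewrite !inE => /orP[] /eqP ->.
have [dd'|ndd'] := boolP (d -- d').
  have := @tn_lex_leq_dom (D :\: [set d; d']) [set d; d'] D [set d; d'] tD.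
  rewrite cardD cards2 neq_dd => le_tn; apply: leq_ltn_trans (le_tn _ _) _.
  - by apply/subsetP => x xD; rewrite in_setU in_setD xD andbT orNb.
  - move=> x; rewrite !inE => /orP[] /eqP ->; left.
      by exists d'; rewrite ?set22 // sedge_sym.
    by exists d; rewrite ?set21.
  by lia.
have [c [dc d'c]] : exists c, d -- c /\ d' -- c.
  apply: contrapT => nc; case/negP: nfar; apply/farP; split=> // c dc d'c.
  by apply: nc; exists c.
have := @tn_lex_leq_dom D [set c] D [set d; d'] tD (subsetUl _ _).
rewrite cardD cards1 => le_tn; apply: leq_ltn_trans (le_tn _) _; last by lia.
move=> x xdd; left; exists c; rewrite ?set11 // sedge_sym.
by move: xdd; rewrite !inE => /orP[] /eqP ->.
Qed.

Lemma tn_lex_lt_between D d d' x : toll_set D -> d \in D -> d' \in D -> x \in D ->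
  between d d' x -> tn GH < 3 * #|D|.
Proof.
move=> tD dD d'D xD bx.
have := @tn_lex_leq_dom D set0 D [set x] tD (subsetUl _ _).
have /= := cardsD1 x D; rewrite xD cards0 => cardD le_tn.
apply: leq_ltn_trans (le_tn _) _; last by lia.
by move=> y; rewrite inE => /eqP ->; right; exists d, d'.
Qed.

Lemma tn_lex_eq3_tn_le2 : tn GH = 3 * tn G -> tn G <= 2.
Proof.
move=> eq_tn; rewrite leqNgt; apply/negP => tn3.
have [D tD cardD] := tn_attained G.
have [d [d' [d'' [dD d'D d''D /and3P[ndd nd'd'' nd''d]]]]] :
  exists x y z, [/\ x \in D, y \in D, z \in D & [&& x != y, y != z & z != x]].
  by move: tn3; rewrite -cardD => /card_gt2P[x [y [z [[? ? ?] [? ? ?]]]]];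
     exists x, y, z; split=> //; apply/and3P.
have nlt : ~ tn GH < 3 * #|D| by rewrite cardD eq_tn ltnn.
have farD y z : y \in D -> z \in D -> y != z -> far y z.
  by move=> yD zD nyz; apply: contrapT => /negP/(tn_lex_lt_nfar tD yD zD nyz).
have := far_triple_between Gconn (farD _ _ dD d'D ndd) (farD d d'' dD d''D _)
  (farD _ _ d'D d''D nd'd''); rewrite eq_sym => /(_ nd''d).
by case/or3P=> b; apply: nlt; apply: (tn_lex_lt_between tD _ _ _ b).
Qed.

End UpperBounds.

Lemma Ext_sub_toll_set (G : sgraph) (D : {set G}) : toll_set D -> Ext G \subset D.
Proof.
move=> /toll_setP covD; apply/subsetP => x /ExtP extx.
by case: (covD x) => // -[u [v [_ _]]]; rewrite (negPf (extx u v)).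
Qed.

(** * Distributions of at most five vertices over the layers *)

Lemma leq_sum_uniq (T : finType) (c : T -> nat) (s : seq T) :
  uniq s -> \sum_(x <- s) c x <= \sum_x c x.
Proof.
move=> s_uniq; rewrite -big_enum /=.
by rewrite big_uniq //= [leqRHS]big_enum /= [leqRHS](bigID (mem s)) leq_addr.
Qed.

Lemma between_among3 (G : sgraph) (a b z g g' x : G) :
  g \in [:: a; b; z] -> g' \in [:: a; b; z] -> between g g' x ->
  [\/ between a b x, between a z x | between b z x].
Proof.
have irr y : between y y x = false by rewrite /between eqxx.
rewrite !inE => /or3P[] /eqP -> /or3P[] /eqP ->; rewrite ?irr // => bx;
  by [constructor 1 | constructor 2 | constructor 3
     | constructor 1; rewrite betweenC | constructor 2; rewrite betweenC
     | constructor 3; rewrite betweenC].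
Qed.

Section LowerBound.
Variables (G : sgraph) (k : nat) (c : G -> nat).
Hypotheses (k_ge3 : 3 <= k) (cov : toll_weight k c) (small : \sum_g c g <= 5).

Lemma weight2 x y : x != y -> c x + c y <= 5.
Proof.
move=> neq_xy; apply: leq_trans small.
have := @leq_sum_uniq _ c [:: x; y]; rewrite !big_cons big_nil addn0.
by apply; rewrite /= inE neq_xy.
Qed.

Lemma weight3 x y z : x != y -> z != x -> z != y -> c x + c y + c z <= 5.
Proof.
move=> neq_xy neq_zx neq_zy; apply: leq_trans small.
have := @leq_sum_uniq _ c [:: x; y; z]; rewrite !big_cons big_nil addn0 addnA.
by apply; rewrite /= !inE negb_or neq_xy !(eq_sym _ z) neq_zx neq_zy.
Qed.

Lemma weight4 x y z t : x != y -> z != x -> z != y -> t != x -> t != y -> t != z ->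
  c x + c y + c z + c t <= 5.
Proof.
move=> neq_xy neq_zx neq_zy neq_tx neq_ty neq_tz; apply: leq_trans small.
have := @leq_sum_uniq _ c [:: x; y; z; t]; rewrite !big_cons big_nil addn0 !addnA.
apply; rewrite /= !inE !negb_or neq_xy !(eq_sym _ z) (negPf neq_zx) neq_zy.
by rewrite !(eq_sym _ t) neq_tx neq_ty neq_tz.
Qed.

Lemma extreme_cov u : u \in Ext G -> (exists2 g, 2 <= c g & g -- u) \/ 3 <= c u.
Proof.
move/ExtP=> extu; case: (cov u) => [?|[g [g' [_ _]]]|le_k]; first by left.
  by rewrite (negPf (extu g g')).
by right; apply: leq_trans le_k.
Qed.

(** With three vertices in the layer of [u] and two in that of [v'], none is left
    to cover the layer of [v']. *)
Lemma heavy_extreme u v v' :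
  far u v -> v -- v' -> 3 <= c u -> 2 <= c v' -> False.
Proof.
move=> /farP[neq_uv nuv far_uv] vv' cu cv'.
have neq_uv' : u != v' by apply: contraNneq nuv => ->; rewrite sedge_sym.
have cuv := weight2 neq_uv'.
have occ g : 0 < c g -> g \in [:: u; v'; v'].
  move=> cg; rewrite !inE orbb; apply/norP => -[neq_gu neq_gv].
  by have := weight3 neq_uv' neq_gu neq_gv; lia.
case: (cov v') => [[g cg gv']|[g [g' [cg cg' bg]]]|le_k]; last by lia.
  have := occ g (ltnW cg); rewrite !inE orbb => /orP[] /eqP eq_g.
    by apply: (far_uv v'); rewrite -?eq_g.
  by rewrite eq_g sedge_irrefl in gv'.
by case: (between_among3 (occ g cg) (occ g' cg') bg) => /between_neq;
  rewrite eqxx ?andbF.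
Qed.

(** Two layers with two vertices each leave at most one vertex for a third
    layer [z]; if there is none, [z] is set to [x]. *)
Lemma occupied_pair x y : x != y -> 2 <= c x -> 2 <= c y ->
  exists z, [/\ forall g, 0 < c g -> g \in [:: x; y; z],
                forall g, 2 <= c g -> g = x \/ g = y &
                z = x \/ [/\ c z = 1, c x = 2 & c y = 2]].
Proof.
move=> neq_xy cx cy; have [[z [cz zx zy]]|noz] :=
  pselect (exists z, [/\ 0 < c z, z != x & z != y]).
  have cxyz := weight3 neq_xy zx zy.
  have occ g : 0 < c g -> g \in [:: x; y; z].
    move=> cg; rewrite !inE; apply: contrapT => /negP.
    rewrite !negb_or => /and3P[gx gy gz].
    by have := weight4 neq_xy zx zy gx gy gz; lia.
  exists z; split=> //; last by right; split; lia.
  move=> g cg; have := occ g (ltnW cg); rewrite !inE.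
  by case/or3P=> /eqP gE; [left | right | move: cg; rewrite gE; lia].
have occ g : 0 < c g -> g = x \/ g = y.
  move=> cg; have [|gx] := eqVneq g x; first by left.
  have [|gy] := eqVneq g y; first by right.
  by case: noz; exists g.
exists x; split; [|by move=> g /ltnW/occ | by left].
by move=> g /occ[]->; rewrite !inE eqxx ?orbT.
Qed.

Lemma pair_member_cov x y z : ~~ (x -- y) ->
  (forall g, 0 < c g -> g \in [:: x; y; z]) ->
  (forall g, 2 <= c g -> g = x \/ g = y) -> 3 <= c x \/ between y z x.
Proof.
move=> nxy occ heavy.
case: (cov x) => [[g /heavy[] -> gx]|[g [g' [cg cg' bg]]]|le_k].
- by rewrite sedge_irrefl in gx.
- by rewrite sedge_sym (negPf nxy) in gx.
- case: (between_among3 (occ g cg) (occ g' cg') bg) => b; last by right.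
    by case/andP: (between_neq b); rewrite eqxx.
  by case/andP: (between_neq b); rewrite eqxx.
by left; apply: leq_trans le_k.
Qed.

(** If [u'] and [v'] are not adjacent, the layer of each of them can only be
    covered with the help of the fifth vertex, in the layer of some [z]: so [u']
    is between [v'] and [z], and [v'] between [u'] and [z].  Then [u] is not
    adjacent to [z], and the detour through [u] at [u'] puts [u] between [v']
    and [z], although [u] is extreme. *)
Lemma heavy_nbrs_adjacent u v u' v' :
  u \in Ext G -> far u v -> u -- u' -> v -- v' -> 2 <= c u' -> 2 <= c v' ->
  u' -- v'.
Proof.
move=> extu /farP[neq_uv nuv far_uv] uu' vv' cu cv.
have neq_uv' : u' != v'.
  by apply/eqP => eq_uv; apply: (far_uv u') => //; rewrite eq_uv.
apply: contrapT => /negP nuv'.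
have [z [occ heavy zP]] := occupied_pair neq_uv' cu cv.
have bu := pair_member_cov nuv' occ heavy.
have bv : 3 <= c v' \/ between u' z v'.
  apply: pair_member_cov => [|g /occ|g /heavy[]]; auto; first by rewrite sedge_sym.
  by rewrite !inE orbCA.
have cuv := weight2 neq_uv'.
case: zP => [eq_z|[_ cu2 cv2]].
  subst z; case: bu => [cu3|/between_neq/andP[]]; last by rewrite eqxx.
  by case: bv => [cv3|]; [lia | rewrite /between eqxx].
case: bu => [|/and4P[neq_vz nvz uz uv]]; first by rewrite cu2.
case: bv => [|/and4P[neq_uz nuz vz vu]]; first by rewrite cv2.
have nuv1 : ~~ (u -- v') by apply/negP => uv'; apply: (far_uv v').
have nzu : ~~ (z -- u).
  apply/negP => zu; case/negP: ((ExtP _ extu) u' z).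
  by apply: common_nbr_between; rewrite // sedge_sym.
case/negP: ((ExtP _ extu) v' z); rewrite /between neq_vz nvz /=.
by apply/andP; split; [apply: connect_trans uz | apply: connect_trans uv];
  apply: connect1; rewrite /away uu' sedge_sym.
Qed.

(** The two hypotheses on neighborhoods handle the case of adjacent [u'], [v']:
    the first one if the layers of [u'] and [v'] hold all the weight, the second
    one if another layer [z] has weight 1. *)
Lemma no_small_weight u v :
  u \in Ext G -> v \in Ext G -> far u v ->
  (forall x y : G, nbh x :|: nbh y <> [set: G]) ->
  (forall u' v', u -- u' -> v -- v' -> u' -- v' ->
     forall z, z \in nbh u' :|: nbh v' ->
     exists2 x, x \notin nbh u' :|: nbh v' &
                x \notin toll_interval u' z :|: toll_interval v' z) -> False.
Proof.
move=> extu extv fuv ndom ntoll; have fvu : far v u by rewrite farC.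
case: (extreme_cov extu) (extreme_cov extv) => [[u' cu u'u]|cu] [[v' cv v'v]|cv].
- have [uu' vv'] : u -- u' /\ v -- v' by split; rewrite sedge_sym.
  have uv' := heavy_nbrs_adjacent extu fuv uu' vv' cu cv.
  have neq_uv' : u' != v' by apply: contraTneq uv' => ->; rewrite sedge_irrefl.
  have cuv := weight2 neq_uv'.
  have [z [occ heavy zP]] := occupied_pair neq_uv' cu cv.
  have covN x : x \notin nbh u' :|: nbh v' -> between u' z x \/ between v' z x.
    rewrite !inE negb_or => /andP[nux nvx].
    case: (cov x) => [[g /heavy[] -> gx]|[g [g' [cg cg' bg]]]|le_k].
    - by rewrite gx in nux.
    - by rewrite gx in nvx.
    - case: (between_among3 (occ g cg) (occ g' cg') bg); auto.
      by case/and4P => _; rewrite uv'.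
    have /heavy[eq_x|eq_x] : 2 <= c x by lia.
      by rewrite eq_x sedge_sym uv' in nvx.
    by rewrite eq_x uv' in nux.
  case: zP => [eq_z|[cz cu2 cv2]].
    subst z; case: (ndom u' v'); apply/setP => x; rewrite [RHS]inE.
    apply: contrapT => /negP/covN[]; rewrite /between ?eqxx //.
    by rewrite (sedge_sym v') uv' andbF.
  have zN : z \in nbh u' :|: nbh v'.
    by apply: contrapT => /negP/covN[] /between_neq/andP[_]; rewrite eqxx.
  have [x xN] := ntoll _ _ uu' vv' uv' z zN.
  by rewrite in_setU negb_or => /andP[/negP xu /negP xv];
    case: (covN x xN) => /between_interval.
- by apply: (heavy_extreme fvu _ cv cu); rewrite sedge_sym.
- by apply: (heavy_extreme fuv _ cu cv); rewrite sedge_sym.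
have neq_uv : u != v by case/farP: fuv.
by have := weight2 neq_uv; lia.
Qed.

End LowerBound.

Theorem theorem4p17 (G H : sgraph)
  (Gconn : connected_graph G) (Gnontriv : nontrivial_graph G)
  (Hconn : connected_graph H) (Hnontriv : nontrivial_graph H)
  (Hncompl : ~ complete_graph H)
  (GExt : 2 <= #|Ext G|) (GnK2 : ~ graph_iso G (Kn 2)) :
  tn (lex_product G H) = 3 * tn G <->
  exists u v : G,
    [/\ [/\ tn G = 2, u != v & Ext G = [set u; v]],
        2 < tn H,
        forall x y : G, nbh x :|: nbh y <> [set: G]
      & 3 <= dist u v /\
        (dist u v = 3 ->
         forall u' v' : G, u' \in nbh u -> v' \in nbh v -> u' -- v' ->
         forall z : G, z \in nbh u' :|: nbh v' ->
         exists2 x : G, x \notin nbh u' :|: nbh v' &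
                        x \notin toll_interval u' z :|: toll_interval v' z)].
Proof.
have lexD (A B : {set G}) := @tn_lex_leqD G H A B Hncompl.
split=> [eq_tn|[u [v [[tnG neq_uv ExtE] tnH ndom [d3 ntoll]]]]]; last first.
  apply/eqP; rewrite eqn_leq tn_lex_leq3 //= tnG ltnNge.
  apply/negP; have [S tS <-] := tn_attained (lex_product G H).
  rewrite -sum_card_layer => small.
  apply: (@no_small_weight G _ _ tnH (layer_weight tS) small u v) => //.
  - by rewrite ExtE set21.
  - by rewrite ExtE set22.
  - exact: dist3_far.
  move=> u' v' uu' vv' uv'; apply: ntoll; rewrite ?inE //.
  apply/eqP; rewrite eqn_leq d3 andbT; apply: dist_leq.
  by apply/has_walkP; exists [:: u'; v'; v]; rewrite /= uu' uv' sedge_sym vv'.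
have [D tD cardD] := tn_attained G.
have le_tn2 := tn_lex_eq3_tn_le2 Gconn Gnontriv Hncompl eq_tn.
have ExtD : Ext G = D.
  apply/eqP; rewrite eqEcard Ext_sub_toll_set //= cardD.
  exact: leq_trans le_tn2 GExt.
have tnG : tn G = 2 by apply/eqP; rewrite eqn_leq le_tn2 -cardD -ExtD.
rewrite tnG in eq_tn cardD.
have /eqP/cards2P[u [v [neq_uv DE]]] := cardD.
have fuv : far u v.
  apply: contrapT => /negP nfar.
  have uD : u \in D by rewrite DE set21.
  have vD : v \in D by rewrite DE set22.
  have := tn_lex_lt_nfar Gconn Gnontriv Hncompl tD uD vD neq_uv nfar.
  by rewrite cardD eq_tn.
exists u, v; split.
- by rewrite ExtD DE.
- by have := tn_lex_leqM G H; rewrite eq_tn tnG; lia.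
(* Pairs in the layers of x and y would be a toll set of size 4. *)
- move=> x y eqT; have := lexD set0 [set x; y].
  rewrite eq_tn cards0 cards2 => le6.
  have : 6 <= 0 + 2 * (x != y).+1.
    apply: le6 => z; left; have : z \in nbh x :|: nbh y by rewrite eqT inE.
    by rewrite !inE => /orP[] zN; [exists x | exists y]; rewrite ?set21 ?set22.
  by case: (x != y).
split; first exact: far_dist3.
move=> _ u' v'; rewrite ![in X in X -> _]inE => uu' vv' uv' z zN.
apply: contrapT => nex.
(* Pairs in the layers of u' and v' and one vertex in the layer of z would be a
   toll set of size 5. *)
have := lexD [set z] [set u'; v'].
rewrite eq_tn cards1 cards2 => le6.
have : 6 <= 1 + 2 * (u' != v').+1; last by case: (u' != v').
apply: le6 => x; have [|xN] := boolP (x \in nbh u' :|: nbh v').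
  by rewrite !inE => /orP[] xN; left; [exists u' | exists v']; rewrite ?set21 ?set22.
right; have xI : x \in toll_interval u' z :|: toll_interval v' z.
  by apply: contrapT => /negP xI; apply: nex; exists x.
have neq_xz : x == z = false by apply: contraNF xN => /eqP ->.
have neq_xu : x == u' = false.
  by apply: contraNF xN => /eqP ->; rewrite !inE (sedge_sym v') uv' orbT.
have neq_xv : x == v' = false by apply: contraNF xN => /eqP ->; rewrite !inE uv'.
move: xI; rewrite in_setU => /orP[] /interval_cases.
  by rewrite neq_xz neq_xu => b; exists u', z; rewrite !inE !eqxx ?orbT.
by rewrite neq_xz neq_xv => b; exists v', z; rewrite !inE !eqxx ?orbT.
Qed.
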